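(* Let $n,m,k$ be integers with $n\ge m\ge 2$ and $n\ge k$. (1) If $k=2$, then $ex(n,m;\mathbb{T}_{k,2})=n+m-2$. (2) If $k\ge 3$ and $m=2$, then $$ex(n,2;\mathbb{T}_{k,2})=\begin{cases} n+\lceil\frac{k}{2}\rceil-1, & \text{if } n\ge\lfloor\frac{3k}{2}\rfloor-1;\\ 2(k-1), & \text{if } n\le\lfloor\frac{3k}{2}\rfloor-1.\end{cases}$$ (3) If $3\le m\le k$, then $$ex(n,m;\mathbb{T}_{k,2})=\begin{cases}(m-2)(k-1)+n, & \text{if } n\ge 2k-1;\\ m(k-1), & \text{if } n\le 2k-2.\end{cases}$$ (4) If $m\ge k+1\ge 4$, then $$ex(n,m;\mathbb{T}_{k,2})=\begin{cases}(k-1)(m-1)+n-m+1, & \text{if } n-m\ge k-1;\\ (k-1)m, & \text{if } n-m\le k-2.\end{cases}$$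
   Context: All graphs are finite, simple and undirected. An $(n,m)$-bipartite graph $G[U,V;E]$ is a bipartite graph whose vertex set is the disjoint union of $U$ and $V$ with $|U|=n$, $|V|=m$, every edge joining a vertex of $U$ to a vertex of $V$. $\mathbb{T}_{k,l}$ is the set of all trees that are $(k,l)$-bipartite graphs, i.e. trees of order $k+l$ whose two colour classes have sizes $k$ and $l$. A graph $G$ contains a tree $T$ as a subgraph if there is an injection $f:V(T)\to V(G)$ with $f(x)f(y)\in E(G)$ whenever $xy\in E(T)$ (no requirement is made on which colour class of $T$ goes to which side of $G$). $ex(n,m;\mathbb{T}_{k,l})$ is the maximum number of edges of an $(n,m)$-bipartite graph that does not contain all trees of $\mathbb{T}_{k,l}$ as subgraphs, i.e. that fails to contain at least one tree of $\mathbb{T}_{k,l}$. *)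

(* Defs.v *)
From mathcomp Require Import all_boot.

Set Implicit Arguments.
Unset Strict Implicit.
Unset Printing Implicit Defensive.

(* An (n, m)-bipartite graph is given by its edge set: U = 'I_n, V = 'I_m, and
   the pair (u, v) stands for the undirected edge uv. *)
Definition bigraph (n m : nat) := {set 'I_n * 'I_m}.

Definition adj (n m : nat) (G : bigraph n m) : rel ('I_n + 'I_m) :=
  fun x y => match x, y with
             | inl u, inr v | inr v, inl u => (u, v) \in G
             | _, _ => false
             end.

Lemma adj_sym (n m : nat) (G : bigraph n m) : symmetric (adj G).
Proof. by case=> x [] y. Qed.

Lemma adj_irrefl (n m : nat) (G : bigraph n m) : irreflexive (adj G).
Proof. by case. Qed.

Definition graph_connected (T : finType) (e : rel T) : bool :=
  (0 < #|T|) && [forall x, forall y, connect e x y].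

(* The length of a cycle is bounded by #|T| only to make the quantification
   finite; see acyclicP. *)
Definition acyclic (T : finType) (e : rel T) : bool :=
  [forall p : 'I_#|T|.+1, forall c : p.-tuple T,
     (2 < p) ==> ~~ ucycleb e c].

Lemma acyclicP (T : finType) (e : rel T) :
  reflect (forall c : seq T, 2 < size c -> ~ ucycle e c) (acyclic e).
Proof.
apply: (iffP forallP) => [acy c c_gt2 /andP[cyc_c uniq_c] | acy p].
  have c_lt : size c < #|T|.+1 by rewrite ltnS -(card_uniqP uniq_c) max_card.
  have /forallP/(_ (in_tuple c)) := acy (Ordinal c_lt).
  by rewrite /= c_gt2 /ucycleb cyc_c uniq_c.
apply/forallP=> c; apply/implyP=> p_gt2; apply/negP.
by apply: acy; rewrite size_tuple.
Qed.

Definition is_tree (T : finType) (e : rel T) : bool :=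
  graph_connected e && acyclic e.

(* Not necessarily induced, and f is free to send either colour class of a
   bipartite e1 to either side of a bipartite e2. *)
Definition is_subgraph (T1 T2 : finType) (e1 : rel T1) (e2 : rel T2) : bool :=
  [exists f : {ffun T1 -> T2},
     injectiveb f && [forall x, forall y, e1 x y ==> e2 (f x) (f y)]].

Definition contains_all_trees (n m k l : nat) (G : bigraph n m) : bool :=
  [forall T : bigraph k l,
     is_tree (adj T) ==> is_subgraph (adj T) (adj G)].

(* ex(n, m; T_{k,l}).  For k, l >= 1 the maximum is over a nonempty family,
   since the edgeless graph contains no tree with an edge. *)
Definition ex_trees (n m k l : nat) : nat :=
  \max_(G : bigraph n m | ~~ contains_all_trees k l G) #|G|.

(* Main.v *)
(** A tree of T_{k,2} is two centres with one common neighbour, all other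
    vertices being leaves.  If G misses such a tree, whose smaller centre has
    degree i + 1 (so 2i < k), then embedding greedily at a vertex y of degree
    at least k shows that every vertex at distance 2 from y has degree at most
    i.  Hence the neighbourhoods N(y) of the big vertices y (degree >= k) of V
    are disjoint; with N their union, V splits into the big vertices, the set S
    of other vertices meeting N, of degree at most i, and the remaining set R,
    whose edges avoid N.  Thus e(G) <= |N| + i |S| + e(U \ N, R).  This yields
    the upper bound for m <= k; for m > k one splits U \ N against R once more
    with the two sides exchanged.  The extremal graphs are a star beside a
    graph of maximum degree k - 1, which contains no vertex of degree k with a
    neighbour of degree 2, and, for m = 2, two overlapping neighbourhoods the
    smaller of which is too small for a balanced tree. *)
Require Import Defs.
From mathcomp Require Import all_boot zify.

Set Implicit Arguments.
Unset Strict Implicit.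
Unset Printing Implicit Defensive.

(** * Separated bipartite relations *)

Section Counting.

Variables (X Y : finType) (g : X -> Y -> bool).
Implicit Types (A : {set X}) (B : {set Y}).

Definition degin A (y : Y) := #|[set x in A | g x y]|.

Definition edges_between A B := \sum_(y in B) degin A y.

Definition separated k i A B :=
  forall y y' x, y \in B -> y' \in B -> x \in A -> y != y' ->
    g x y -> g x y' -> k <= degin A y -> degin A y' <= i.

Lemma degin_sub A A' y : A' \subset A -> degin A' y <= degin A y.
Proof.
move=> sAA; apply: subset_leq_card; apply/subsetP=> x.
by rewrite !inE => /andP[/(subsetP sAA)-> ->].
Qed.

Lemma degin_le A y : degin A y <= #|A|.
Proof. by apply: subset_leq_card; apply/subsetP=> x; rewrite !inE => /andP[]. Qed.

(** Shrinking [A] strengthens the premise on [y] and weakens the conclusion on [y']. This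
    inheritance allows a second split on what the first one leaves over. *)
Lemma separated_sub k i A B A' B' :
  A' \subset A -> B' \subset B -> separated k i A B -> separated k i A' B'.
Proof.
move=> sA sB sep y y' x yB y'B xA ne gy gy' k_le.
apply: leq_trans (degin_sub y' sA) _.
apply: sep gy gy' _ => //; [exact: (subsetP sB)|exact: (subsetP sB)| |].
  exact: (subsetP sA).
exact: leq_trans k_le (degin_sub y sA).
Qed.

Lemma edges_between_le A B d :
  {in B, forall y, degin A y <= d} -> edges_between A B <= d * #|B|.
Proof. by move=> dB; rewrite mulnC -sum_nat_const; apply: leq_sum. Qed.

Lemma edges_betweenE A B :
  edges_between A B = \sum_(x in A) #|[set y in B | g x y]|.
Proof.
transitivity (\sum_(y in B) \sum_(x in A | g x y) 1).
  by apply: eq_bigr => y _; rewrite sum1_card; apply: eq_card => x; rewrite !inE.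
rewrite (exchange_big_dep (mem A)) /=; last by move=> ? ? _ /andP[].
apply: eq_bigr => x xA; rewrite sum1_card; apply: eq_card => y.
by rewrite !inE unfold_in /= xA.
Qed.

(** Here [b] counts the big vertices. Two of them sharing a neighbour would give [k <= i], so the
    edges at big vertices form disjoint stars and number at most [#|N|]. When [b = 0], all degrees
    are below [k]. *)
Lemma star_split k i A B : i < k -> separated k i A B ->
  exists (N : {set X}) (S R : {set Y}) (b : nat),
    [/\ N \subset A, R \subset B, b + #|S| + #|R| = #|B|
      & [/\ 0 < b \/ {in B, forall y, degin A y < k},
           {in R, forall y, degin A y < k}
         & edges_between A B <= #|N| + i * #|S| + edges_between (A :\: N) R]].
Proof.
move=> ltik sep.
pose big := [set y in B | k <= degin A y].
pose N := [set x in A | [exists y in big, g x y]].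
pose R := [set y in B :\: big | [forall x in N, ~~ g x y]].
pose S := (B :\: big) :\: R.
have sRB : R \subset B :\: big by apply/subsetP=> y; rewrite inE => /andP[].
have sbB : big \subset B by apply/subsetP=> y; rewrite inE => /andP[].
exists N, S, R, #|big|; split.
- by apply/subsetP=> x; rewrite inE => /andP[].
- exact: subset_trans sRB (subsetDl _ _).
- have := cardsID big B; have := cardsID R (B :\: big).
  rewrite (setIidPr sbB) (setIidPr sRB) -/S; lia.
split.
- case: (set_0Vmem big) => [b0|[y yb]]; last by left; apply/card_gt0P; exists y.
  right=> y yB; rewrite ltnNge; apply/negP=> ky.
  by have := in_set0 y; rewrite -b0 inE yB ky.
- by move=> y /(subsetP sRB); rewrite !inE => /andP[+ yB]; rewrite yB -ltnNge.
rewrite /edges_between (big_setID big) /= (setIidPr sbB) -addnA.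
apply: leq_add.
  rewrite -/(edges_between A big) edges_betweenE.
  rewrite -[#|N|]sum1_card [leqRHS]big_mkcond [leqLHS]big_mkcond /=.
  (* Pointwise in [x]: at most one big neighbour inside [N], none outside. *)
  apply: leq_sum => x _; case: ifP => // xA; case: ifP => [_|/negP xN].
    apply/card_le1P => y; rewrite inE => /andP[yb gy] y'; rewrite !inE.
    apply/idP/eqP => [/andP[/andP[y'B ky'] gy']|->]; last by move: yb; rewrite inE => ->.
    move: yb; rewrite inE => /andP[yB ky]; apply/eqP/negP => /negP ne.
    by have := sep _ _ _ y'B yB xA ne gy' gy ky'; lia.
  rewrite leqn0 cards_eq0; apply/eqP/setP=> y; rewrite in_set0 inE.
  apply/negP=> /andP[yb gy]; apply: xN; rewrite inE xA.
  by apply/existsP; exists y; rewrite yb.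
rewrite (big_setID R) /= (setIidPr sRB) -/S addnC; apply: leq_add.
  rewrite mulnC -sum_nat_const; apply: leq_sum => y; rewrite inE => /andP[yR yBb].
  move: yR; rewrite [y \in R]inE yBb /= negb_forall => /existsP[x].
  rewrite negb_imply negbK => /andP[xN gy]; move: yBb; rewrite !inE => /andP[y_nb yB].
  move: xN; rewrite inE => /andP[xA /existsP[z /andP[zb gz]]].
  apply: sep gz gy _ => //; first exact: (subsetP sbB).
    by apply: contraNneq y_nb => <-; move: zb; rewrite inE.
  by move: zb; rewrite inE => /andP[].
apply: leq_sum => y yR; apply: subset_leq_card; apply/subsetP=> x.
rewrite !inE => /andP[xA gy]; rewrite xA gy !andbT /=.
apply/negP=> xex; move: yR; rewrite inE => /andP[_ /forallP/(_ x)].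
by rewrite inE xA xex gy.
Qed.

End Counting.

Lemma edges_betweenC (X Y : finType) (g : X -> Y -> bool)
    (A : {set X}) (B : {set Y}) :
  edges_between g A B = edges_between (fun y x => g x y) B A.
Proof. exact: edges_betweenE. Qed.

Lemma edges_between_le_minn (X Y : finType) (g : X -> Y -> bool) k
    (A : {set X}) (B : {set Y}) :
  {in B, forall y, degin g A y < k} ->
  edges_between g A B <= minn k.-1 #|A| * #|B|.
Proof.
move=> dB; apply: edges_between_le => y yB.
by rewrite leq_min degin_le andbT; have := dB y yB; lia.
Qed.

(* s, r and n' are the sizes of S, R and A :\: N in the splitting. *)
Lemma edges_le_separated (X Y : finType) (g : X -> Y -> bool) k i
    (A : {set X}) (B : {set Y}) :
  i < k -> separated g k i A B ->
  edges_between g A B <= k.-1 * #|B| \/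
  exists s r (n' : nat), s + r < #|B| /\
    edges_between g A B + n' <= #|A| + i * s + minn k.-1 n' * r.
Proof.
move=> ltik /(star_split ltik)[N [S [R [b [sN sR cB [b_gt0 dR le_e]]]]]].
case: b_gt0 => [b_gt0|dB]; last first.
  left; apply: edges_between_le => y yB; have := dB y yB; lia.
right; exists #|S|, #|R|, #|A :\: N|; split; first lia.
have dR' : {in R, forall y, degin g (A :\: N) y < k}.
  by move=> y yR; apply: leq_ltn_trans (degin_sub g y (subsetDl _ _)) (dR y yR).
have := edges_between_le_minn dR'; have := cardsID N A.
rewrite (setIidPr sN); lia.
Qed.

(* Splits with respect to both sides in turn, the first split leaving R and
   A :\: N; the second is needed only when R is the larger one. *)
Lemma edges_le_separated2 (X Y : finType) (g : X -> Y -> bool) k i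
    (A : {set X}) (B : {set Y}) :
  2 < k -> i + 2 <= k -> separated g k i A B ->
  separated (fun y x => g x y) k i B A ->
  edges_between g A B <= k.-1 * #|B| \/
  edges_between g A B <= (k - 2) * #|B|.-1 + #|A|.
Proof.
move=> k_gt2 ik2 sepB sepA; have ltik : i < k by lia.
have [N [S [R [b [sN sR cB [b_gt0 dR le_e]]]]]] := star_split ltik sepB.
case: b_gt0 => [b_gt0|dB]; last first.
  left; apply: edges_between_le => y yB; have := dB y yB; lia.
right; set A' := A :\: N in le_e.
have cA : #|N| + #|A'| = #|A| by rewrite -(cardsID N A) (setIidPr sN).
have sA' : A' \subset A by apply: subsetDl.
have dR' : {in R, forall y, degin g A' y < k}.
  by move=> y yR; apply: leq_ltn_trans (degin_sub g y sA') (dR y yR).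
suff le_e' : edges_between g A' R <= (k - 2) * #|R| + #|A'|.
  have : i * #|S| <= (k - 2) * #|S| by rewrite leq_mul2r; lia.
  have : (k - 2) * (#|S| + #|R|) <= (k - 2) * #|B|.-1 by rewrite leq_mul2l; lia.
  rewrite mulnDr; lia.
have [leRA|ltAR] := leqP #|R| #|A'|.
  apply: leq_trans (edges_between_le_minn dR') _.
  have : minn k.-1 #|A'| * #|R| <= (k - 2).+1 * #|R| by rewrite leq_mul2r; lia.
  rewrite mulSn; lia.
have := star_split ltik (separated_sub sR sA' sepA).
move=> [M [S' [R' [c [sM sR' cA' [_ dR'' le_e']]]]]].
rewrite edges_betweenC; apply: leq_trans le_e' _.
set RM := R :\: M.
have cR : #|M| + #|RM| = #|R| by rewrite -(cardsID M R) (setIidPr sM).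
have sRM : RM \subset R by apply: subsetDl.
(* After both splits all degrees are below [k] on either side, so the remaining edges can be counted
   from the smaller side. *)
have le1 : edges_between (fun y x => g x y) RM R' <= k.-1 * #|R'|.
  apply: edges_between_le => x xR'.
  have := dR'' x xR'; have := degin_sub (fun y x => g x y) x sRM; lia.
have le2 : edges_between (fun y x => g x y) RM R' <= k.-1 * #|RM|.
  rewrite -edges_betweenC; apply: edges_between_le => y yRM.
  have := dR' y (subsetP sRM _ yRM); have := degin_sub g y sR'; lia.
have leS : i * #|S'| <= (k - 2) * #|S'| by rewrite leq_mul2r; lia.
have [j kE] : exists j, k = j.+3 by exists (k - 3); lia.
subst k; rewrite /= ?subSS ?subn0 in le1 le2 leS *.
(* Let [t] be the smaller of [#|R'|] and [#|RM|]. Then [#|S'| + t <= #|A'| <= #|R|], taken [j]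
   times, is added to [#|M| + #|S'| + 2 * t <= #|R| + #|A'|]. *)
have [] := leqP #|R'| #|RM|; nia.
Qed.

(** * Embedding trees *)

Lemma injection_into (T1 T2 : finType) (w0 : T2) (P : {set T1}) (W : {set T2}) :
  #|P| <= #|W| ->
  exists h : T1 -> T2, {in P &, injective h} /\ {in P, forall x, h x \in W}.
Proof.
move=> le_PW; pose h x := nth w0 (enum W) (index x (enum P)).
have h_lt x : x \in P -> index x (enum P) < size (enum W).
  by move=> xP; rewrite -cardE (leq_trans _ le_PW) // cardE index_mem mem_enum.
exists h; split=> [x x' xP x'P /eqP|x xP].
  rewrite nth_uniq ?enum_uniq ?h_lt // => /eqP.
  by move/(congr1 (nth x (enum P))); rewrite !nth_index ?mem_enum.
by rewrite -mem_enum mem_nth ?h_lt.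
Qed.

Lemma eq_of_neq_I2 (p t t' : 'I_2) : t != p -> t' != p -> t = t'.
Proof. by case: p t t' => [[|[|p]] ?] [[|[|t]] ?] [[|[|t']] ?] //= ? ?; apply: val_inj. Qed.

(* Placing the leaves at y first leaves enough room at z, since z has degree at
   least k, the number of all neighbours of the two centres. *)
Lemma broom_embedding (Z : finType) (e : rel Z) k (T : bigraph k 2)
    (p : 'I_2) (c : 'I_k) (y z w : Z) :
  symmetric e -> irreflexive e -> ~~ e y z -> y != z -> e y w -> e z w ->
  (c, p) \in T ->
  (forall x t, t != p -> (x, p) \in T -> (x, t) \in T -> x = c) ->
  #|[set x | (x, p) \in T]| <= #|[set x | e y x]| -> k <= #|[set x | e z x]| ->
  is_subgraph (adj T) e.
Proof.
move=> e_sym e_irr nyz neq_yz eyw ezw cp c_uniq.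
set P := [set x | (x, p) \in T] => degy degz.
have cP : c \in P by rewrite inE.
have [] := @injection_into _ _ w (P :\ c) ([set x | e y x] :\ w).
  by move: degy; rewrite (cardsD1 c) cP (cardsD1 w [set x | e y x]) inE eyw.
move=> h1 [inj1 in1]; pose W := h1 @: (P :\ c).
have cW : #|W| = #|P|.-1 by rewrite card_in_imset // [in RHS](cardsD1 c) cP.
(* The other [k - #|P|] vertices fit: [z] has at least [k] neighbours, of which [w] and at most
   [#|P| - 1] images are taken. *)
have [] := @injection_into _ _ w (~: P) (([set x | e z x] :\ w) :\: W).
  have := cardsC P; rewrite card_ord.
  have := cardsID W ([set x | e z x] :\ w).
  have := subset_leq_card (subsetIr ([set x | e z x] :\ w) W).
  have := cardsD1 w [set x | e z x]; rewrite inE ezw.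
  have : 0 < #|P| by apply/card_gt0P; exists c.
  lia.
move=> h2 [inj2 in2].
pose fl x := if x == c then w else if x \in P then h1 x else h2 x.
have fl_nbr x : e y (fl x) || e z (fl x).
  rewrite /fl; case: eqP => [_|/eqP xc]; first by rewrite eyw.
  case: ifPn => xP.
    by have := in1 x; rewrite in_setD1 xc xP !inE => /(_ isT) /andP[_ ->].
  by have := in2 x; rewrite in_setC xP !inE => /(_ isT) /and3P[_ _ ->]; rewrite orbT.
have fl_inj : injective fl.
  have h1w x : x != c -> x \in P -> h1 x != w.
    by move=> xc xP; have := in1 x; rewrite in_setD1 xc xP !inE => /(_ isT) /andP[].
  have h2w x : x \notin P -> h2 x != w.
    by move=> xP; have := in2 x; rewrite in_setC xP !inE => /(_ isT) /and3P[].
  have h12 x x' : x != c -> x \in P -> x' \notin P -> h1 x != h2 x'.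
    move=> xc xP x'P; have := in2 x'; rewrite in_setC x'P => /(_ isT).
    rewrite inE => /andP[+ _]; apply: contraNneq => <-.
    by apply: imset_f; rewrite in_setD1 xc.
  move=> x x'; rewrite /fl.
  case: eqP => [->|/eqP xc]; case: eqP => [->//|/eqP x'c].
  - by case: ifPn => x'P /eqP; rewrite eq_sym => /eqP/eqP;
      [have := h1w x' x'c x'P|have := h2w x' x'P] => /negP.
  - by case: ifPn => xP /eqP; [have := h1w x xc xP|have := h2w x xP] => /negP.
  case: ifPn => xP; case: ifPn => x'P.
  - by apply: inj1; rewrite in_setD1 ?xc ?x'c.
  - by move/eqP; rewrite (negPf (h12 _ _ xc xP x'P)).
  - by move/eqP; rewrite eq_sym (negPf (h12 _ _ x'c x'P xP)).
  - by apply: inj2; rewrite in_setC.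
pose f (s : 'I_k + 'I_2) :=
  match s with inl x => fl x | inr t => if t == p then y else z end.
have e_fr x t : (x, t) \in T -> e (f (inl x)) (f (inr t)).
  move=> xt; rewrite e_sym /= /fl.
  case: (eqVneq t p) xt => [->|tp] xt; case: eqP => // /eqP xc.
    have xP : x \in P by rewrite inE.
    by rewrite xP; have := in1 x; rewrite in_setD1 xc xP !inE => /(_ isT) /andP[].
  case: ifPn => [|xP]; first by rewrite inE => xp; rewrite (c_uniq x t tp xp xt) eqxx in xc.
  by have := in2 x; rewrite in_setC xP !inE => /(_ isT) /and3P[].
(* Every image [fl x] is adjacent to [y] or [z], whereas [y] and [z] are adjacent neither to each
   other nor to themselves. *)
have fl_r x t : fl x != f (inr t).
  have := fl_nbr x; apply: contraTneq => -> /=.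
  by case: ifP => _; rewrite e_irr ?orbF // e_sym.
apply/existsP; exists (finfun f); apply/andP; split.
  apply/injectiveP => s s'; rewrite !ffunE.
  case: s s' => [x|t] [x'|t'].
  - by move/fl_inj->.
  - by move/eqP; rewrite (negPf (fl_r _ _)).
  - by move/eqP; rewrite eq_sym (negPf (fl_r _ _)).
  move=> /=; case: eqP => [->|/eqP tp]; case: eqP => [->|/eqP t'p] //.
  - by move/eqP; rewrite (negPf neq_yz).
  - by move/eqP; rewrite eq_sym (negPf neq_yz).
  by rewrite (eq_of_neq_I2 tp t'p).
apply/forallP => s; apply/forallP => s'; apply/implyP; rewrite !ffunE.
case: s s' => [x|t] [x'|t'] //; first exact: e_fr.
by rewrite [in X in _ -> X]e_sym; apply: e_fr.
Qed.

(** A vertex adjacent to neither centre would be isolated, two common neighbours would close a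
    4-cycle, and without any the star at [p] would be a component missing [q]. *)
Lemma adj_tree_common_nbr k (T : bigraph k 2) (p q : 'I_2) :
  p != q -> is_tree (adj T) ->
  exists c, [/\ (c, p) \in T, (c, q) \in T,
    forall x, (x, p) \in T -> (x, q) \in T -> x = c
    & forall x, ((x, p) \in T) || ((x, q) \in T)].
Proof.
move=> pq /andP[/andP[_ /forallP conn] /acyclicP acy].
have {}conn s s' : connect (adj T) s s' by apply/forallP: s'.
have pVq t : (t == p) || (t == q).
  case: eqVneq => //= tp; apply/eqP; apply: (@eq_of_neq_I2 p) => //.
  by rewrite eq_sym.
have cover x : ((x, p) \in T) || ((x, q) \in T).
  apply: contraT; rewrite negb_or => /andP[xp xq].
  have cl : closed (adj T) (pred1 (inl x : 'I_k + 'I_2)).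
    apply: intro_closed; first exact/sym_connect_sym/adj_sym.
    move=> s s' + /eqP def_s; rewrite def_s; case: s' => // t /= xt.
    by move: (pVq t) xt => /orP[] /eqP->; rewrite ?(negPf xp) ?(negPf xq).
  by have := closed_connect cl (conn (inl x) (inr p)); rewrite !inE eqxx.
case: (pickP [pred c | ((c, p) \in T) && ((c, q) \in T)]) => [c /andP[cp cq]|none].
  exists c; split=> // x xp xq; apply/eqP/negPn/negP => xc.
  apply: (acy [:: inl x; inr p; inl c; inr q]) => //.
  rewrite /ucycle /= !inE xp xq cp cq /=.
  by rewrite (inj_eq inl_inj) (inj_eq inr_inj) (negPf xc) pq.
have cl : closed (adj T) [pred s : 'I_k + 'I_2 |
    match s with inl x => (x, p) \in T | inr t => t == p end].
  apply: intro_closed; first exact/sym_connect_sym/adj_sym.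
  move=> [x|t] [x'|t'] //=; rewrite !inE.
    move=> xt xp; have := none x; rewrite /= xp /=.
    by case/orP: (pVq t') xt => /eqP-> // ->.
  by move=> xt /eqP tp; rewrite -tp.
have := closed_connect cl (conn (inr p) (inr q)).
by rewrite !inE eqxx eq_sym (negPf pq).
Qed.

Lemma card_adj_inr n m (G : bigraph n m) v :
  #|[set s | adj G (inr v) s]| = degin (fun u v => (u, v) \in G) setT v.
Proof.
rewrite /degin -(card_imset _ (@inl_inj 'I_n 'I_m)).
apply: eq_card => -[u|v']; rewrite !inE /=.
  by rewrite mem_imset ?inE //; exact: inl_inj.
by apply/esym/negbTE/imsetP => -[].
Qed.

Lemma card_adj_inl n m (G : bigraph n m) u :
  #|[set s | adj G (inl u) s]| = degin (fun v u => (u, v) \in G) setT u.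
Proof.
rewrite /degin -(card_imset _ (@inr_inj 'I_n 'I_m)).
apply: eq_card => -[u'|v]; rewrite !inE /=.
  by apply/esym/negbTE/imsetP => -[].
by rewrite mem_imset ?inE //; exact: inr_inj.
Qed.

(** The degrees of the two centres sum to [k + 1], so the smaller one is [i + 1] with [2 * i < k]. A
    violation of separation on either side of [G] would let the missing tree be embedded with both
    centres on that side. *)
Lemma separated_of_missing_tree n m k (G : bigraph n m) :
  ~~ contains_all_trees k 2 G ->
  exists i, [/\ 2 * i < k,
    separated (fun u v => (u, v) \in G) k i setT setT
    & separated (fun v u => (u, v) \in G) k i setT setT].
Proof.
rewrite negb_forall => /existsP[T]; rewrite negb_imply => /andP[treeT nsub].
pose nb p := [set x | (x, p) \in T].
have [p [q [pq le_pq]]] : exists p q : 'I_2, p != q /\ #|nb p| <= #|nb q|.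
  have [le|lt] := leqP #|nb ord0| #|nb ord_max|; first by exists ord0, ord_max.
  by exists ord_max, ord0; split=> //; apply: ltnW.
have [c [cp cq c_uniq cover]] := adj_tree_common_nbr pq treeT.
have c_nb : #|nb p| + #|nb q| = k + 1.
  rewrite -cardsUI; congr (_ + _).
    by rewrite -[RHS]card_ord; apply: eq_card => x; rewrite !inE cover.
  rewrite -[RHS](cards1 c); apply: eq_card => x; rewrite !inE.
  by apply/andP/eqP => [[]|->//]; apply: c_uniq.
have nbp_gt0 : 0 < #|nb p| by apply/card_gt0P; exists c; rewrite inE.
have c_uniq' x t : t != p -> (x, p) \in T -> (x, t) \in T -> x = c.
  by move=> tp; rewrite (eq_of_neq_I2 tp (_ : q != p)) 1?eq_sym //; apply: c_uniq.
exists #|nb p|.-1; split; first lia.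
  move=> z y x _ _ _ zy xz xy le_z; rewrite leqNgt; apply: contra nsub => lt_y.
  apply: (@broom_embedding _ (adj G) k T p c (inr y) (inr z) (inl x)) => //.
  - exact: adj_sym.
  - exact: adj_irrefl.
  - by rewrite eq_sym.
  - by rewrite card_adj_inr -/(nb p); lia.
  - by rewrite card_adj_inr.
move=> z y x _ _ _ zy xz xy le_z; rewrite leqNgt; apply: contra nsub => lt_y.
apply: (@broom_embedding _ (adj G) k T p c (inl y) (inl z) (inr x)) => //.
- exact: adj_sym.
- exact: adj_irrefl.
- by rewrite eq_sym.
- by rewrite card_adj_inl -/(nb p); lia.
- by rewrite card_adj_inl.
Qed.

(** * Extremal graphs *)

Lemma ucycle_two_nbrs (T : eqType) (e : rel T) (s : seq T) x :
  ucycle e s -> 2 < size s -> x \in s ->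
  exists y z, [/\ y \in s, z \in s, y != z, e x y & e z x].
Proof.
move=> /andP[cyc_s uniq_s] s_gt2 /rot_to[i p def_p].
have mem_p z : (z \in s) = (z \in x :: p) by rewrite -def_p mem_rot.
move: cyc_s uniq_s s_gt2; rewrite -(rot_cycle i) -(rot_uniq i) -(size_rot i) def_p.
case: p mem_p {def_p} => [|y [|y' p]] // mem_p /=.
rewrite rcons_path => /and4P[exy _ _ ezx] /and3P[_ y_nin _] _.
exists y, (last y' p); split=> //; rewrite ?mem_p ?inE ?eqxx ?orbT //.
  by move: (mem_last y' p); rewrite inE => ->; rewrite !orbT.
by apply: contraNneq y_nin => ->; apply: mem_last.
Qed.

(* The two centres are the vertices of 'I_2; their common neighbour is i. *)
Definition double_broom k i : bigraph k 2 :=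
  [set s : 'I_k * 'I_2 | if s.2 == ord0 then s.1 <= i else i <= s.1].

(** On a cycle each vertex has two distinct neighbours. Only vertex [i] is adjacent to both centres,
    so it is the only non-centre possible, and then no centre can lie on the cycle either. *)
Lemma double_broom_tree k i : i < k -> is_tree (adj (double_broom k i)).
Proof.
move=> ltik; pose c := Ordinal ltik; set e := adj _.
have e_sym : symmetric e by apply: adj_sym.
have c_r t : e (inl c) (inr t) by rewrite /e /= inE /= leqnn if_same.
have conn s : connect e (inl c) s.
  case: s => [x|t]; last exact: connect1.
  have [le|lt] := leqP x i.
    apply: connect_trans (connect1 (c_r ord0)) (connect1 _).
    by rewrite /e /= inE.
  apply: connect_trans (connect1 (c_r ord_max)) (connect1 _).
  by rewrite /e /= inE /= ltnW.
apply/andP; split.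
  apply/andP; split; first by apply/card_gt0P; exists (inl c).
  apply/forallP => s; apply/forallP => s'.
  by apply: connect_trans (conn s'); rewrite (sym_connect_sym e_sym).
apply/acyclicP => s s_gt2 cyc_s.
have only_c x : inl x \in s -> x = c.
  move=> /(ucycle_two_nbrs cyc_s s_gt2)[[?|t] [[?|t'] []]] // _ _ tt' xt xt'.
  apply/val_inj/eqP; rewrite eqn_leq.
  move: tt' xt xt'; rewrite /e /= !inE /=.
  by case: t t' => [[|[|t]] ?] [[|[|t']] ?] //= _ -> ->.
have no_r t : inr t \notin s.
  apply/negP => /(ucycle_two_nbrs cyc_s s_gt2)[[x|?] [[x'|?] []]] //.
  by move=> /only_c -> /only_c ->; rewrite eqxx.
case: s s_gt2 cyc_s only_c no_r => // -[x|t] s s_gt2 cyc_s only_c no_r; last first.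
  by have := no_r t; rewrite inE eqxx.
have /(ucycle_two_nbrs cyc_s s_gt2)[[?|t] [z [ts _ _ ext _]]] // : inl x \in inl x :: s.
  by rewrite inE eqxx.
by have := no_r t; rewrite ts.
Qed.

Lemma card_nbr_embedding (T1 T2 : finType) (e1 : rel T1) (e2 : rel T2) f x :
  injective f -> (forall y z, e1 y z -> e2 (f y) (f z)) ->
  #|[set y | e1 x y]| <= #|[set y | e2 (f x) y]|.
Proof.
move=> f_inj f_hom; rewrite -(card_imset _ f_inj).
apply/subset_leq_card/subsetP => _ /imsetP[y + ->].
by rewrite !inE => /f_hom.
Qed.

Lemma missing_double_broom n m k i (G : bigraph n m) : i < k ->
  (forall f : 'I_k + 'I_2 -> 'I_n + 'I_m, injective f ->
     ~ forall s t, adj (double_broom k i) s t -> adj G (f s) (f t)) ->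
  ~~ contains_all_trees k 2 G.
Proof.
move=> ltik no_f; apply/negP => /forallP/(_ (double_broom k i)).
rewrite double_broom_tree //= => /existsP[f /andP[/injectiveP f_inj f_hom]].
apply: (no_f f f_inj) => s t.
by move/forallP: f_hom => /(_ s)/forallP/(_ t)/implyP.
Qed.

Lemma card_ord_pred n (Q : pred nat) :
  #|[set x : 'I_n | Q x]| = \sum_(0 <= x < n) Q x.
Proof.
rewrite -sum1_card big_mkord [LHS]big_mkcond.
by apply: eq_bigr => x _; rewrite inE; case: (Q x).
Qed.

Lemma sum_ltn n d : d <= n -> \sum_(0 <= x < n) (x < d) = d.
Proof.
move=> le_dn; rewrite (big_cat_nat (n := d)) //=.
rewrite (eq_big_nat _ _ (F2 := fun=> 1)) => [|x /andP[_ ->] //].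
rewrite [X in _ + X](eq_big_nat _ _ (F2 := fun=> 0)) => [|x /andP[le _]].
  by rewrite !sum_nat_const_nat muln0 addn0 muln1 subn0.
by rewrite ltnNge le.
Qed.

Lemma double_broom_nbr_inr1 k i :
  i < k -> #|[set s | adj (double_broom k i) (inr ord_max) s]| = k - i.
Proof.
move=> ltik; rewrite card_adj_inr /degin.
rewrite (_ : [set x in _ | _] = ~: [set x : 'I_k | x < i]).
  by rewrite cardsCs setCK card_ord (card_ord_pred _ (fun x => x < i)) sum_ltn // ltnW.
by apply/setP => x; rewrite !inE /= leqNgt.
Qed.

Lemma double_broom_nbr_inr0 k i :
  i < k -> #|[set s | adj (double_broom k i) (inr ord0) s]| = i.+1.
Proof.
move=> ltik; rewrite card_adj_inr /degin.
rewrite (_ : [set x in _ | _] = [set x : 'I_k | x < i.+1]).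
  by rewrite (card_ord_pred _ (fun x => x < i.+1)) sum_ltn.
by apply/setP => x; rewrite !inE.
Qed.

(* The missing tree is [double_broom k 0]: K_{1,k} with a pendant edge attached
   to one of its leaves. *)
Lemma missing_pendant_star n m k (G : bigraph n m) : 1 < k ->
  (forall u v, (u, v) \in G ->
     let du := #|[set t | adj G (inl u) t]| in
     let dv := #|[set t | adj G (inr v) t]| in
     [|| (du < k) && (dv < k), du <= 1 | dv <= 1]) ->
  ~~ contains_all_trees k 2 G.
Proof.
move=> k_gt1 lowdeg; have k_gt0 : 0 < k by apply: ltnW.
apply: (missing_double_broom k_gt0) => f f_inj f_hom.
pose c := Ordinal k_gt0.
have c_r t : adj (double_broom k 0) (inr t) (inl c) by rewrite /= inE if_same.
(* The image of the edge from the large centre to [c] has an end of degree at least [k] and the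
   other of degree at least 2, against all three alternatives. *)
have deg_r := card_nbr_embedding (inr ord_max) f_inj f_hom.
rewrite double_broom_nbr_inr1 // subn0 in deg_r.
have deg_c : 1 < #|[set s | adj G (f (inl c)) s]|.
  apply: leq_trans (card_nbr_embedding (inl c) f_inj f_hom).
  apply/card_gt1P; exists (inr ord0), (inr ord_max).
  by rewrite !inE /= !inE.
have := f_hom _ _ (c_r ord_max); move: deg_r deg_c.
case: (f (inr _)) (f (inl _)) => [u|v] [u'|v'] //= deg_r deg_c /lowdeg /=; lia.
Qed.

(** Translation by [v] permutes the residues modulo [p]; it gives the degrees of circulant
    graphs. *)
Lemma sum_modn_shift p v (F : nat -> nat) :
  \sum_(0 <= u < p) F ((u + v) %% p) = \sum_(0 <= u < p) F u.
Proof.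
elim: v => [|v <-].
  by apply: eq_big_nat => u /andP[_ ltup]; rewrite addn0 modn_small.
case: p => [|p]; first by rewrite !big_geq.
rewrite [LHS]big_nat_recr //= [RHS]big_nat_recl //= addnC; congr (_ + _).
  by rewrite addnS -addSn modnDl.
by apply: eq_bigr => u _; rewrite addnS -addSn.
Qed.

(* When m = q + 1, a star on the last vertex of V and the last n - p vertices of
   U, next to a p x q graph with all V-degrees d; when m = q, only the latter. *)
Definition circulant_star n m p q d : bigraph n m :=
  [set s : 'I_n * 'I_m | if s.2 < q then (s.1 < p) && ((s.1 + s.2) %% p < d)
                         else p <= s.1].

Lemma degin_circulant_star n m p q d v : d <= p -> p <= n ->
  degin (fun u v => (u, v) \in circulant_star n m p q d) setT v =
  if v < q then d else n - p.
Proof.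
move=> le_dp le_pn; rewrite /degin.
case: ifPn => vq; last first.
  rewrite (_ : [set x in _ | _] = ~: [set x : 'I_n | x < p]).
    by rewrite cardsCs setCK card_ord (card_ord_pred _ (fun x => x < p)) sum_ltn.
  by apply/setP => x; rewrite !inE /= (negPf vq) leqNgt.
rewrite (_ : [set x in _ | _] = [set x : 'I_n | (x < p) && ((x + v) %% p < d)]).
  rewrite (card_ord_pred _ (fun x => (x < p) && ((x + v) %% p < d))).
  rewrite (big_cat_nat (n := p)) //=.
  rewrite [X in _ + X](eq_big_nat _ _ (F2 := fun=> 0)) => [|x /andP[le _]].
    rewrite sum_nat_const_nat muln0 addn0 -[RHS](sum_ltn le_dp).
    rewrite -[RHS](sum_modn_shift p v (fun x => nat_of_bool (x < d))).
    by apply: eq_big_nat => x /andP[_ ->].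
  by rewrite ltnNge le.
by apply/setP => x; rewrite !inE /= vq.
Qed.

Lemma card_bigraph n m (G : bigraph n m) :
  #|G| = edges_between (fun u v => (u, v) \in G) setT setT.
Proof.
rewrite edges_betweenE -sum1_card.
under [RHS]eq_bigr => u _ do rewrite -sum1_card.
rewrite pair_big_dep /=; apply: eq_bigl => -[u v]; by rewrite !inE.
Qed.

Lemma card_circulant_star n m p q d : d <= p -> p <= n -> q <= m ->
  #|circulant_star n m p q d| = q * d + (m - q) * (n - p).
Proof.
move=> le_dp le_pn le_qm; rewrite card_bigraph /edges_between.
under eq_bigr => v _ do rewrite degin_circulant_star //.
rewrite (eq_bigl xpredT) => [|v]; last by rewrite inE.
rewrite -(big_mkord xpredT (fun v => if v < q then d else n - p)).
rewrite (big_cat_nat (n := q)) //=; congr (_ + _).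
  rewrite (eq_big_nat _ _ (F2 := fun=> d)) => [|v /andP[_ ->] //].
  by rewrite sum_nat_const_nat subn0.
rewrite (eq_big_nat _ _ (F2 := fun=> n - p)) => [|v /andP[le _]].
  by rewrite sum_nat_const_nat.
by rewrite ltnNge le.
Qed.

(** If [q <= p], the shifts at a fixed [u] are distinct residues, so degrees in the circulant block
    are at most [d < k] on both sides; otherwise [d <= 1] bounds those in V. As [m <= q.+1], the
    star has one centre and its leaves have degree 1. *)
Lemma circulant_star_missing n m p q d k :
  1 < k -> d <= p -> p <= n -> q <= m -> m <= q.+1 -> d < k ->
  (q <= p) || (d <= 1) ->
  ~~ contains_all_trees k 2 (circulant_star n m p q d).
Proof.
move=> k_gt1 le_dp le_pn le_qm le_mq lt_dk q_small.
apply: missing_pendant_star => // u v uvG /=.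
rewrite card_adj_inl card_adj_inr degin_circulant_star //.
move: uvG; rewrite inE /=; case: ifPn => [vq /andP[up _]|vq up].
  case/orP: q_small => [le_qp|->]; last by rewrite !orbT.
  rewrite lt_dk andbT; apply/orP; left; apply: leq_ltn_trans lt_dk.
  rewrite /degin (_ : [set x in _ | _] =
      [set x : 'I_m | (x < q) && ((x + u) %% p < d)]); last first.
    apply/setP => x; rewrite !inE /= up addnC; case: ifP => // _.
    by rewrite leqNgt up.
  rewrite (card_ord_pred _ (fun x => (x < q) && ((x + u) %% p < d))).
  rewrite (big_cat_nat (n := q)) //=.
  rewrite [X in _ + X](eq_big_nat _ _ (F2 := fun=> 0)) => [|x /andP[le _]].
    rewrite sum_nat_const_nat muln0 addn0 -[leqRHS](sum_ltn le_dp).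
    rewrite -[leqRHS](sum_modn_shift p u (fun x => nat_of_bool (x < d))).
    rewrite [leqRHS](big_cat_nat (n := q)) //=; apply: leq_trans (leq_addr _ _).
    by apply: leq_sum => x _; case: (x < q).
  by rewrite ltnNge le.
apply/orP; right; apply/orP; left; apply/card_le1_eqP => x y; rewrite !inE /=.
have := ltn_ord x; have := ltn_ord y; move: up => /[dup] + up.
case: ifP => xq; case: ifP => yq; rewrite ?(ltnNge u p) ?up //= => *; apply: val_inj => /=; lia.
Qed.

Lemma ex_trees_ge n m k l (G : bigraph n m) :
  ~~ contains_all_trees k l G -> #|G| <= ex_trees n m k l.
Proof. by move=> ?; apply: (leq_bigmax_cond (P := fun G => ~~ contains_all_trees k l G)). Qed.

Lemma ex_trees_ge_circulant_star n m p q d k :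
  1 < k -> d <= p -> p <= n -> q <= m -> m <= q.+1 -> d < k ->
  (q <= p) || (d <= 1) ->
  q * d + (m - q) * (n - p) <= ex_trees n m k 2.
Proof.
move=> *; rewrite -(@card_circulant_star n m p q d) //.
by apply/ex_trees_ge/circulant_star_missing.
Qed.

(** One vertex of V is joined to all of U, the other to only [i] vertices. Both centres of the
    balanced broom have degree above [i], so in V they would collide; in U, they would force [k > 2]
    vertices into the two of V. *)
Lemma ex_trees_ge_overlap n k : 2 < k -> k <= n ->
  n + (k.-1)./2 <= ex_trees n 2 k 2.
Proof.
move=> k_gt2 le_kn; set i := (k.-1)./2; have ltik : i < k by rewrite /i; lia.
pose G : bigraph n 2 := [set s : 'I_n * 'I_2 | (s.2 == ord0) || (s.1 < i)].
have deg1 t : t != ord0 -> degin (fun u v => (u, v) \in G) setT t = i.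
  move=> t0; rewrite /degin (_ : [set x in _ | _] = [set x : 'I_n | x < i]).
    by rewrite (card_ord_pred _ (fun x => x < i)) sum_ltn //; lia.
  by apply/setP => x; rewrite !inE /= (negPf t0).
have deg0 : degin (fun u v => (u, v) \in G) setT ord0 = n.
  by rewrite -[RHS]card_ord; apply: eq_card => x; rewrite !inE.
have -> : n + i = #|G|.
  rewrite card_bigraph /edges_between (eq_bigl xpredT) => [|v]; last by rewrite inE.
  by rewrite big_ord_recl big_ord1 deg0 deg1.
apply/ex_trees_ge/(missing_double_broom ltik) => f f_inj f_hom.
pose c := Ordinal ltik.
have c_r t : adj G (f (inr t)) (f (inl c)).
  by apply: f_hom; rewrite /= inE /= leqnn if_same.
have deg_r t : i < #|[set s | adj G (f (inr t)) s]|.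
  apply: leq_trans (card_nbr_embedding (inr t) f_inj f_hom).
  case: (eqVneq t ord0) => [->|t0]; first by rewrite double_broom_nbr_inr0.
  rewrite (@eq_of_neq_I2 ord0 t ord_max) // double_broom_nbr_inr1 // /i; lia.
case def_c : (f (inl c)) => [u|v].
  have r_inr t : exists2 t', f (inr t) = inr t' & t' = ord0.
    move: (c_r t) (deg_r t); rewrite def_c; case: (f (inr t)) => // t' _.
    by rewrite card_adj_inr; case: (eqVneq t' ord0) => [->|t0]; [exists ord0 | rewrite deg1 ?ltnn].
  have [t0 f0 t00] := r_inr ord0; have [t1 f1 t10] := r_inr ord_max.
  by have /f_inj := etrans f0 (etrans (congr1 inr (etrans t00 (esym t10))) (esym f1)).
have r_inl t : exists u, f (inr t) = inl u.
  by move: (c_r t); rewrite def_c; case: (f (inr t)) => // u; exists u.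
have l_inr x : exists v, f (inl x) = inr v.
  have [t xt] : exists t, adj (double_broom k i) (inr t) (inl x).
    by have [le|lt] := leqP x i; [exists ord0 | exists ord_max]; rewrite /= inE //= ltnW.
  have [w fw] := r_inl t; move: (f_hom _ _ xt); rewrite fw.
  by case: (f (inl x)) => // v'; exists v'.
pose h x := if f (inl x) is inr v' then v' else ord0.
have h_inj : injective h.
  move=> x y; rewrite /h.
  have [vx fx] := l_inr x; have [vy fy] := l_inr y.
  by rewrite fx fy => vxy; apply: inl_inj (f_inj _ _ _); rewrite fx fy vxy.
by have := leq_card h h_inj; rewrite !card_ord; lia.
Qed.

(** * The extremal numbers *)

Lemma ex_trees_le n m k l b :
  (forall G : bigraph n m, ~~ contains_all_trees k l G -> #|G| <= b) ->
  ex_trees n m k l <= b.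
Proof. by move=> le_b; apply/bigmax_leqP. Qed.

Lemma card_missing_tree n m k (G : bigraph n m) : ~~ contains_all_trees k 2 G ->
  #|G| <= k.-1 * m \/
  exists i s r n', [/\ 2 * i < k, s + r < m &
    #|G| + n' <= n + i * s + minn k.-1 n' * r].
Proof.
move=> /separated_of_missing_tree[i [ltik sep _]].
have lt_ik : i < k by lia.
have := edges_le_separated lt_ik sep.
rewrite -card_bigraph !cardsT !card_ord => -[|[s [r [n' [lt_m le]]]]]; first by left.
by right; exists i, s, r, n'.
Qed.

(** The only tree of order 2 + 2 with these classes is the path on four vertices, for which
    [i = 0]. *)
Lemma ex_trees_le_P4 n m : 1 < n -> 1 < m -> ex_trees n m 2 2 <= n + m - 2.
Proof.
move=> n_gt1 m_gt1; apply: ex_trees_le => G.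
move=> /card_missing_tree[|[i [s [r [n' [lt2 lt_m]]]]]]; first by lia.
have -> : i = 0 by lia.
by case: n' => [|n'] /=; rewrite ?min0n ?minn0 ?minnSS ?min0n; lia.
Qed.

Lemma ex_trees_le_two n k :
  ex_trees n 2 k 2 <= maxn (n + (k.-1)./2) (2 * k.-1).
Proof.
apply: ex_trees_le => G.
move=> /card_missing_tree[|[i [s [r [n' [lt2 lt_m]]]]]]; first by lia.
(* At most one of [s], [r] is nonzero, and it is then 1: [s] contributes [i], while the contribution
   of [r] cancels against [n']. *)
case: r lt_m => [|[|r]] lt_m; [case: s lt_m => [|[|s]] lt_m| case: s lt_m => [|s] lt_m|]; lia.
Qed.

Lemma ex_trees_le_one_sided n m k : 2 < m ->
  ex_trees n m k 2 <= maxn ((m - 2) * k.-1 + n) (m * k.-1).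
Proof.
move=> m_gt2; apply: ex_trees_le => G.
move=> /card_missing_tree[|[i [s [r [n' [lt2 lt_m]]]]]]; first by lia.
move=> le; rewrite leq_max; apply/orP; left.
have [q def_m] : exists q, m = q.+3 by exists (m - 3); lia.
subst m; rewrite (_ : q.+3 - 2 = q.+1); last lia.
(* If [R] is nonempty, one of its vertices absorbs [n'], and the at most [m - 2] others in [S] and
   [R] cost at most [k.-1] each. *)
case: r lt_m le => [|r] lt_m le; last first.
  have : i * s <= k.-1 * s by rewrite leq_mul2r; lia.
  have : minn k.-1 n' * r <= k.-1 * r by rewrite leq_mul2r; lia.
  have : k.-1 * (s + r) <= k.-1 * q.+1 by rewrite leq_mul2l; lia.
  rewrite mulnS in le; rewrite mulnDr; lia.
(* For empty [R], [2 * i <= k.-1] and [s <= m - 1 <= 2 * (m - 2)]. *)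
have : (2 * i) * s <= k.-1 * q.+2 by apply: leq_mul; lia.
have : k.-1 * q.+2 <= 2 * (k.-1 * q.+1) by rewrite mulnCA leq_mul2l; lia.
lia.
Qed.

Lemma ex_trees_le_two_sided n m k : 2 < k ->
  ex_trees n m k 2 <= maxn ((k - 2) * m.-1 + n) (k.-1 * m).
Proof.
move=> k_gt2; apply: ex_trees_le => G.
move=> /separated_of_missing_tree[i [lt_ik sepV sepU]].
have ik2 : i + 2 <= k by lia.
have := edges_le_separated2 k_gt2 ik2 sepV sepU.
by rewrite -card_bigraph !cardsT !card_ord leq_max => -[] ->; rewrite ?orbT.
Qed.

Theorem theorem1p7 (n m k : nat) (hmn : m <= n) (hm : 2 <= m) (hkn : k <= n) :
  (k = 2 -> ex_trees n m k 2 = n + m - 2) /\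
  (3 <= k -> m = 2 ->
     ((3 * k)./2 - 1 <= n -> ex_trees n 2 k 2 = n + uphalf k - 1) /\
     (n <= (3 * k)./2 - 1 -> ex_trees n 2 k 2 = 2 * (k - 1))) /\
  (3 <= m -> m <= k ->
     (2 * k - 1 <= n -> ex_trees n m k 2 = (m - 2) * (k - 1) + n) /\
     (n <= 2 * k - 2 -> ex_trees n m k 2 = m * (k - 1))) /\
  (k + 1 <= m -> 4 <= k + 1 ->
     (k - 1 <= n - m ->
        ex_trees n m k 2 = (k - 1) * (m - 1) + (n - m) + 1) /\
     (n - m <= k - 2 -> ex_trees n m k 2 = (k - 1) * m)).
Proof.
split; [|split; [|split]].
- move=> k2; subst k; apply/eqP; rewrite eqn_leq (ex_trees_le_P4 hkn hm).
  (* Two disjoint stars, centred on opposite sides. *)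
  have := @ex_trees_ge_circulant_star n m 1 m.-1 1 2; rewrite (_ : m - m.-1 = 1); lia.
- move=> k_ge3 m2; have := ex_trees_le_two n k; split=> n_k.
    have := ex_trees_ge_overlap k_ge3 hkn; lia.
  have := @ex_trees_ge_circulant_star n 2 n 2 k.-1 k; rewrite subnn mul0n addn0; lia.
- move=> m_ge3 le_mk; have := ex_trees_le_one_sided n k m_ge3.
  have [q def_m] : exists q, m = q.+3 by exists (m - 3); lia.
  have [j def_k] : exists j, k = j.+3 by exists (k - 3); lia.
  subst m k; rewrite !subn1 (succnK j.+2) (_ : q.+3 - 2 = q.+1); last lia.
  move=> le_ex.
  split=> n_k; apply/eqP; rewrite eqn_leq; apply/andP; split.
  (* The two terms of the maximum differ by [n - 2 * (k - 1)], whence the threshold on [n]. *)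
  - apply: leq_trans le_ex _; rewrite geq_max; apply/andP; split; nia.
  (* With [p = d = k - 1] the block is complete bipartite, of sides [k - 1] and [m - 1], beside a
     star. *)
  - apply: leq_trans _ (@ex_trees_ge_circulant_star n _ j.+2 q.+2 j.+2 _ _ _ _ _ _ _ _);
      rewrite ?(subSnn q.+2); lia.
  - by apply: leq_trans le_ex _; rewrite geq_max; apply/andP; split; nia.
  (* No star: [q = m], and every vertex of V has degree [k - 1]. *)
  apply: leq_trans _ (@ex_trees_ge_circulant_star n _ n q.+3 j.+2 _ _ _ _ _ _ _ _); lia.
- move=> lt_km k_ge3; have := @ex_trees_le_two_sided n m k.
  have [q def_m] : exists q, m = q.+3 by exists (m - 3); lia.
  have [j def_k] : exists j, k = j.+3 by exists (k - 3); lia.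
  subst m k; rewrite !subn1 (succnK j.+2) (succnK q.+2) (_ : j.+3 - 2 = j.+1); last lia.
  move=> /(_ isT) le_ex.
  split=> n_k; apply/eqP; rewrite eqn_leq; apply/andP; split.
  - by apply: leq_trans le_ex _; rewrite geq_max; apply/andP; split; nia.
  (* A [k - 1]-regular graph with both sides of size [m - 1], beside a star with [n - m + 1]
     edges. *)
  - apply: leq_trans _ (@ex_trees_ge_circulant_star n _ q.+2 q.+2 j.+2 _ _ _ _ _ _ _ _);
      rewrite ?(subSnn q.+2); lia.
  - by apply: leq_trans le_ex _; rewrite geq_max; apply/andP; split; nia.
  apply: leq_trans _ (@ex_trees_ge_circulant_star n _ n q.+3 j.+2 _ _ _ _ _ _ _ _); lia.
Qed.
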